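(* Let $X$ be a real Banach space, let $B$ be the closed unit ball of $X^*$, and let $K \subseteq B$ be a nonempty weak* compact Radon-Nikodym set. Let $L(X)$ be the Banach space of functions on $B$ defined in the context, with norm $L(\cdot)$, and regard $B$ (hence $K$) as a subset of $L(X)^*$ via $x^* \mapsto \delta_{x^*}$, $\delta_{x^*}(f) = f(x^* )$. Let $\lambda_n : L(X) \to L(X)^*$ ($n = 1,2,\dots$) be norm to norm continuous functions with $\|\lambda_n(f)\| \le 1$ for all $n$ and all $f \in L(X)$, such that for every $f \in L(X)$ the limit $\lambda_0(f) = \lim_n \lambda_n(f)$ exists in norm, $\lambda_0(f) \in K$, and $f(\lambda_0(f)) = \sup_{K} f$. Let $\mathcal{C} \subseteq L(X)$ be the set of all concave functions $f \in L(X)$ with $L(f) \le 1$. Then $$K = \overline{\lambda_0(\mathcal{C})}^{\,\text{norm}}.$$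
   Context: $L(X)$ is the smallest norm-closed linear lattice of real functions on $B$ containing the constants and (the restrictions to $B$ of) the elements of $X$, viewed as functions $x^* \mapsto x^*(x)$, inside the space of all functions that are both weak* continuous on $B$ and Lipschitz with respect to the norm of $X^*$; lattice operations are pointwise and the norm is $$L(f)= \max\Bigl\{ \sup_{\|x^*\| \le 1} |f(x^* )|,\ \sup_{x^* \ne y^*,\ \|x^*\|\le 1,\ \|y^*\|\le 1} \frac{|f(x^* ) - f(y^* )|}{\|x^* - y^*\|} \Bigr\}.$$ The map $x^* \mapsto \delta_{x^*}$ is an isometry from $B$ (with the norm of $X^*$) into $L(X)^*$, so a point $x^* \in B$ is identified with $\delta_{x^*}$ and it does not matter in which of the two dual norms the closure is taken. For $f\in L(X)$, $f(\lambda_0(f))$ denotes the value of $f$ at the point of $K\subseteq B$ identified with $\lambda_0(f)$. ''Concave'' means concave as a function on the convex set $B \subseteq X^*$. A weak* compact set $K \subseteq X^*$ is a Radon-Nikodym set if for every separable Banach space $Y$ and every bounded linear operator $U : Y \to X$ the set $U^*(K)$ is norm separable in $Y^*$. It is known that this is equivalent to: for every regular Borel (for the weak* topology) measure $\mu$ on $K$ and every $\epsilon>0$ there is a norm compact $K_\epsilon \subseteq K$ with $|\mu|(K_\epsilon) > |\mu|(K) - \epsilon$. For such $K$, sequences $(\lambda_n)$ as in the statement are known to exist. *)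

(* Defs.v *)
From HB Require Import structures.
From mathcomp Require Import all_boot all_order all_algebra.
From mathcomp Require Import all_classical all_reals all_analysis.
From mathcomp Require Import lra.

Set Implicit Arguments.
Unset Strict Implicit.
Unset Printing Implicit Defensive.

Import Order.TTheory GRing.Theory Num.Theory.
Import numFieldNormedType.Exports.

Local Open Scope classical_set_scope.
Local Open Scope ring_scope.

(* For linear maps between normed spaces, bounded and continuous are the same
   (linear_bounded_continuous). *)
Definition continuous_functional {R : realType} (V : normedModType R) :
  {pred V -> R^o} := fun f => `[< linear f /\ continuous f >].
Arguments continuous_functional {R} V.

(* The topological dual, with the operator norm. *)
Record dual_space {R : realType} (V : normedModType R) := Dual {
  dual_fun :> V -> R^o ;
  dual_funP : dual_fun \in continuous_functional V }.

HB.instance Definition _ {R : realType} (V : normedModType R) :=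
  [isSub for @dual_fun R V].
HB.instance Definition _ {R : realType} (V : normedModType R) :=
  [Choice of dual_space V by <:].

Lemma continuous_functional_submod_closed {R : realType} (V : normedModType R) :
  submod_closed (continuous_functional V).
Proof.
split.
  apply/asboolP; split; first by move=> a u v /=; rewrite scaler0 addr0.
  exact: cst_continuous.
move=> a f g /asboolP[lf cf] /asboolP[lg cg]; apply/asboolP; split.
  move=> b u v; rewrite /= !fctE lf lg /= !scalerDr !scalerA (mulrC a b).
  by rewrite addrACA.
by move=> x; apply: cvgD; [apply: cvgZr; exact: cf|exact: cg].
Qed.

HB.instance Definition _ {R : realType} (V : normedModType R) :=
  GRing.isSubmodClosed.Build R (V -> R^o) (continuous_functional V)
    (GRing.submod_closed_semi (continuous_functional_submod_closed V)).
HB.instance Definition _ {R : realType} (V : normedModType R) :=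
  [SubChoice_isSubLmodule of dual_space V by <:].

Section dual_norm.
Context {R : realType} (V : normedModType R).
Implicit Types f g : dual_space V.

Lemma dual_linear f : linear (f : V -> R^o).
Proof. by have /asboolP[] := dual_funP f. Qed.

Lemma dual_continuous f : continuous (f : V -> R^o).
Proof. by have /asboolP[] := dual_funP f. Qed.

HB.instance Definition _ f :=
  GRing.isLinear.Build R V R^o _ (dual_fun f) (dual_linear f).

Definition dual_norm f : R := sup [set `|f x| | x in [set x : V | `|x| <= 1]].

Lemma dual_norm_has_sup f :
  has_sup [set `|f x| | x in [set x : V | `|x| <= 1]].
Proof.
split; first by exists `|f 0|, 0 => //=; rewrite normr0.
have /linear_bounded_continuous/linear_boundedP := @dual_continuous f.
move=> /pinfty_ex_gt0[M M0 fM]; exists M => _ [x /= x1 <-].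
by rewrite (le_trans (fM x))// ler_piMr// ltW.
Qed.

Lemma dual_norm_ub f x : `|x| <= 1 -> `|f x| <= dual_norm f.
Proof.
move=> x1; apply: ub_le_sup; first by have [] := dual_norm_has_sup f.
by exists x.
Qed.

Lemma dual_norm_ge0 f : 0 <= dual_norm f.
Proof. by apply: le_trans (@dual_norm_ub f 0 _); rewrite ?normr0. Qed.

Lemma dual_norm_lub f c :
  (forall x, `|x| <= 1 -> `|f x| <= c) -> dual_norm f <= c.
Proof.
move=> fc; apply: ge_sup; first by have [] := dual_norm_has_sup f.
by move=> _ [x /= /fc ? <-].
Qed.

Lemma dual_normD f g : dual_norm (f + g) <= dual_norm f + dual_norm g.
Proof.
apply: dual_norm_lub => x x1; apply: le_trans (ler_normD _ _) _.
by apply: lerD; exact: dual_norm_ub.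
Qed.

Lemma dual_normZ a f : dual_norm (a *: f) = `|a| * dual_norm f.
Proof.
have le b h : dual_norm (b *: h) <= `|b| * dual_norm h.
  apply: dual_norm_lub => x x1; rewrite [X in `|X|](_ : _ = b * h x)//.
  by rewrite normrM ler_wpM2l// dual_norm_ub.
apply/eqP; rewrite eq_le le /=.
have [->|a0] := eqVneq a 0; first by rewrite normr0 mul0r dual_norm_ge0.
rewrite -ler_pdivlMl ?normr_gt0// -normfV.
by rewrite -{1}[f](scalerK a0) le.
Qed.

Lemma dual_norm_eq0 f : dual_norm f = 0 -> f = 0.
Proof.
move=> f0; apply/val_inj/funext => x.
have [->|x0] := eqVneq x 0; first exact: linear0.
have : `|f (`|x|^-1 *: x)| <= 0.
  rewrite -f0; apply: dual_norm_ub.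
  by rewrite normrZ normfV normr_id mulVf// normr_eq0.
rewrite normr_le0 linearZ /= scaler_eq0 invr_eq0 normr_eq0 (negbTE x0) /=.
by move=> /eqP.
Qed.

HB.instance Definition _ :=
  Lmodule_isNormed.Build R (dual_space V) dual_normD dual_normZ dual_norm_eq0.

Lemma dual_normE f : `|f| = dual_norm f. Proof. by []. Qed.

End dual_norm.

(* The same space with the topology of pointwise convergence. *)
Definition weak_star {R : realType} (V : normedModType R) : Type := dual_space V.

HB.instance Definition _ {R : realType} (V : normedModType R) :=
  Topological.copy (weak_star V)
    (initial_topology (fun f : dual_space V => (dual_fun f : {ptws V -> R^o}))).

(* The closed unit ball of the dual; as a type it carries no topology, which
   forces the choice between norm and weak* to be explicit. *)
Record dual_ball {R : realType} (V : normedModType R) := DualBall {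
  ball_val :> dual_space V ;
  ball_valP : `|ball_val| <= 1 }.

HB.instance Definition _ {R : realType} (V : normedModType R) :=
  [isSub for @ball_val R V].
HB.instance Definition _ {R : realType} (V : normedModType R) :=
  [Choice of dual_ball V by <:].

Definition weak_star_ball {R : realType} (V : normedModType R) : Type :=
  dual_ball V.

HB.instance Definition _ {R : realType} (V : normedModType R) :=
  Topological.copy (weak_star_ball V)
    (initial_topology (fun b : dual_ball V => (ball_val b : weak_star V))).

Lemma dual_ball0_subproof {R : realType} (V : normedModType R) :
  `|0 : dual_space V| <= 1.
Proof. by rewrite normr0. Qed.

Definition dual_ball0 {R : realType} (V : normedModType R) : dual_ball V :=
  DualBall (dual_ball0_subproof V).

(* Functions on the ball that are weak* continuous and norm Lipschitz; they are
   normed below by the maximum of the sup norm and the Lipschitz constant. *)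
Definition wlip_functional {R : realType} (V : normedModType R) :
    {pred dual_ball V -> R^o} :=
  fun f => `[< continuous (f : weak_star_ball V -> R^o) /\
    exists k : R, forall x y : dual_ball V,
      `|f x - f y| <= k * `|ball_val x - ball_val y| >].
Arguments wlip_functional {R} V.

Record wlip {R : realType} (V : normedModType R) := Wlip {
  wlip_fun :> dual_ball V -> R^o ;
  wlip_funP : wlip_fun \in wlip_functional V }.

HB.instance Definition _ {R : realType} (V : normedModType R) :=
  [isSub for @wlip_fun R V].
HB.instance Definition _ {R : realType} (V : normedModType R) :=
  [Choice of wlip V by <:].

Lemma continuous_lincomb {R : realType} (T : topologicalType) (a : R)
    (f g : T -> R^o) :
  continuous f -> continuous g -> continuous (a *: f + g).
Proof.
by move=> cf cg x; apply: cvgD; [apply: cvgZr; exact: cf|exact: cg].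
Qed.

Lemma wlip_functional_submod_closed {R : realType} (V : normedModType R) :
  submod_closed (wlip_functional V).
Proof.
split.
  apply/asboolP; split; first exact: cst_continuous.
  by exists 0 => x y; rewrite mul0r subrr normr0.
move=> a f g /asboolP[cf [k fk]] /asboolP[cg [l gl]]; apply/asboolP; split.
  exact: (continuous_lincomb (T := weak_star_ball V)).
exists (`|a| * k + l) => x y.
rewrite [X in `|X|](_ : _ = a * (f x - f y) + (g x - g y)); last first.
  by rewrite !fctE /= mulrBr opprD addrACA.
rewrite mulrDl -mulrA (le_trans (ler_normD _ _))// lerD// normrM.
by rewrite ler_wpM2l.
Qed.

HB.instance Definition _ {R : realType} (V : normedModType R) :=
  GRing.isSubmodClosed.Build R (dual_ball V -> R^o) (wlip_functional V)
    (GRing.submod_closed_semi (wlip_functional_submod_closed V)).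
HB.instance Definition _ {R : realType} (V : normedModType R) :=
  [SubChoice_isSubLmodule of wlip V by <:].

Section wlip_norm.
Context {R : realType} (V : normedModType R).
Implicit Types (f g : wlip V) (x y : dual_ball V).

Lemma wlip_continuous f : continuous (f : weak_star_ball V -> R^o).
Proof. by have /asboolP[] := wlip_funP f. Qed.

Lemma wlip_lipschitz f : exists k : R, forall x y,
  `|f x - f y| <= k * `|ball_val x - ball_val y|.
Proof. by have /asboolP[] := wlip_funP f. Qed.

Definition sup_norm f : R := sup (range (fun x : dual_ball V => `|f x|)).

(* If V is the zero space this is the supremum of the empty set,
   which is 0 by convention. *)
Definition lip_const f : R := sup [set r | exists x y : dual_ball V,
  x <> y /\ r = `|f x - f y| / `|ball_val x - ball_val y|].

Definition wlip_norm f : R := Num.max (sup_norm f) (lip_const f).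

Lemma ball_dist_gt0 x y : x <> y -> 0 < `|ball_val x - ball_val y|.
Proof.
by move=> xy; rewrite normr_gt0 subr_eq0; apply/eqP => /val_inj.
Qed.

Lemma sup_norm_has_sup f : has_sup (range (fun x : dual_ball V => `|f x|)).
Proof.
split; first by exists `|f (dual_ball0 V)|, (dual_ball0 V).
have [k fk] := wlip_lipschitz f.
exists (`|f (dual_ball0 V)| + `|k|) => _ [x _ <-].
rewrite -[f x](subrK (f (dual_ball0 V))) (le_trans (ler_normD _ _))//.
rewrite addrC lerD2l (le_trans (fk _ _))//= subr0.
rewrite (le_trans (ler_norm _))// normrM normr_id ler_piMr//.
exact: ball_valP.
Qed.

Lemma lip_const_has_ubound f : has_ubound [set r | exists x y : dual_ball V,
  x <> y /\ r = `|f x - f y| / `|ball_val x - ball_val y|].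
Proof.
have [k fk] := wlip_lipschitz f; exists k => _ [x [y [xy ->]]].
by rewrite ler_pdivrMr ?ball_dist_gt0.
Qed.

Lemma wlip_norm_ub f x : `|f x| <= wlip_norm f.
Proof.
rewrite le_max; apply/orP; left; apply: ub_le_sup; last by exists x.
by have [] := sup_norm_has_sup f.
Qed.

Lemma wlip_norm_lip f x y : `|f x - f y| <= wlip_norm f * `|ball_val x - ball_val y|.
Proof.
have [->|/eqP xy] := eqVneq x y; first by rewrite !subrr !normr0 mulr0.
rewrite -ler_pdivrMr ?ball_dist_gt0// le_max; apply/orP; right.
by apply: ub_le_sup; [exact: lip_const_has_ubound|exists x, y].
Qed.

Lemma wlip_norm_lub f c : (forall x, `|f x| <= c) ->
  (forall x y, `|f x - f y| <= c * `|ball_val x - ball_val y|) -> wlip_norm f <= c.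
Proof.
move=> fc lc; rewrite ge_max; apply/andP; split.
  by apply: ge_sup; [have [] := sup_norm_has_sup f|move=> _ [x _ <-]].
rewrite /lip_const; set A := (X in sup X).
have [->|/set0P A0] := eqVneq A set0.
  by rewrite sup0 (le_trans _ (fc (dual_ball0 V))).
apply: ge_sup => // _ [x [y [xy ->]]].
by rewrite ler_pdivrMr ?ball_dist_gt0.
Qed.

Lemma wlip_norm_ge0 f : 0 <= wlip_norm f.
Proof. exact: le_trans (wlip_norm_ub f (dual_ball0 V)). Qed.

Lemma wlip_normD f g : wlip_norm (f + g) <= wlip_norm f + wlip_norm g.
Proof.
apply: wlip_norm_lub => [x|x y].
  by rewrite (le_trans (ler_normD _ _))// lerD// wlip_norm_ub.
rewrite [X in `|X|](_ : _ = (f x - f y) + (g x - g y)); last first.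
  by rewrite [X in X - _]/(f x + g x) [X in _ - X]/(f y + g y) opprD addrACA.
by rewrite (le_trans (ler_normD _ _))// mulrDl lerD// wlip_norm_lip.
Qed.

Lemma wlip_normZ a f : wlip_norm (a *: f) = `|a| * wlip_norm f.
Proof.
have le b h : wlip_norm (b *: h) <= `|b| * wlip_norm h.
  apply: wlip_norm_lub => [x|x y].
    by rewrite [X in `|X|]/(b * h x) normrM ler_wpM2l// wlip_norm_ub.
  rewrite [X in `|X|](_ : _ = b * (h x - h y)); last by rewrite mulrBr.
  by rewrite normrM -mulrA ler_wpM2l// wlip_norm_lip.
apply/eqP; rewrite eq_le le /=.
have [->|a0] := eqVneq a 0; first by rewrite normr0 mul0r wlip_norm_ge0.
rewrite -ler_pdivlMl ?normr_gt0// -normfV.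
by rewrite -{1}[f](scalerK a0) le.
Qed.

Lemma wlip_norm_eq0 f : wlip_norm f = 0 -> f = 0.
Proof.
move=> f0; apply/val_inj/funext => x; apply/eqP.
by rewrite -normr_le0 -f0 wlip_norm_ub.
Qed.

HB.instance Definition _ :=
  Lmodule_isNormed.Build R (wlip V) wlip_normD wlip_normZ wlip_norm_eq0.

End wlip_norm.

Section lattice_operations.
Context {R : realType} (V : normedModType R).
Implicit Types (f g : wlip V) (x : V).

Lemma wlip_maxP f g :
  (fun b : dual_ball V => Num.max (f b) (g b)) \in wlip_functional V.
Proof.
apply/asboolP; split.
  move=> b; exact: (@continuous_max _ (weak_star_ball V) f g b
    (@wlip_continuous _ _ f b) (@wlip_continuous _ _ g b)).
exists (Num.max (wlip_norm f) (wlip_norm g)) => a b.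
have := wlip_norm_lip f a b; have := wlip_norm_lip g a b.
have := normr_ge0 (ball_val a - ball_val b); set d := `|_ - _|.
rewrite !ler_norml; case: (lerP (f a) (g a)); case: (lerP (f b) (g b));
  case: (lerP (wlip_norm f) (wlip_norm g)); nra.
Qed.

Lemma wlip_minP f g :
  (fun b : dual_ball V => Num.min (f b) (g b)) \in wlip_functional V.
Proof.
apply/asboolP; split.
  move=> b; exact: (@continuous_min _ (weak_star_ball V) f g b
    (@wlip_continuous _ _ f b) (@wlip_continuous _ _ g b)).
exists (Num.max (wlip_norm f) (wlip_norm g)) => a b.
have := wlip_norm_lip f a b; have := wlip_norm_lip g a b.
have := normr_ge0 (ball_val a - ball_val b); set d := `|_ - _|.
rewrite !ler_norml; case: (lerP (f a) (g a)); case: (lerP (f b) (g b));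
  case: (lerP (wlip_norm f) (wlip_norm g)); nra.
Qed.

Lemma wlip_cstP (c : R) : (fun=> c) \in wlip_functional V.
Proof.
apply/asboolP; split; first exact: cst_continuous.
by exists 0 => a b; rewrite subrr normr0 mul0r.
Qed.

Lemma dual_le_norm (f : dual_space V) x : `|f x| <= `|f| * `|x|.
Proof.
have [->|x0] := eqVneq x 0; first by rewrite linear0 !normr0 mulr0.
have xgt0 : 0 < `|x| by rewrite normr_gt0.
have : `|f (`|x|^-1 *: x)| <= `|f|.
  by apply: dual_norm_ub; rewrite normrZ normfV normr_id mulVf// gt_eqF.
by rewrite linearZ /= normrM normfV normr_id mulrC ler_pdivrMr.
Qed.

Lemma wlip_evalP x : (fun b : dual_ball V => b x) \in wlip_functional V.
Proof.
apply/asboolP; split.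
  have comp (S T U : topologicalType) (h : S -> T) (k : T -> U) :
    continuous h -> continuous k -> continuous (k \o h).
    by move=> ch ck s; apply: continuous_comp; [exact: ch|exact: ck].
  have c1 : continuous (fun f : weak_star V => dual_fun f x : R^o).
    apply: (comp (weak_star V) {ptws V -> R^o} R^o (@dual_fun R V) (@^~ x)).
      exact: initial_continuous.
    exact: (@proj_continuous V (fun=> R^o) x).
  apply: (comp (weak_star_ball V) (weak_star V) R^o (@ball_val R V) _ _ c1).
  exact: initial_continuous.
exists `|x| => a b; rewrite mulrC.
exact: (dual_le_norm (ball_val a - ball_val b)).
Qed.

Definition wlip_max f g : wlip V := Wlip (wlip_maxP f g).
Definition wlip_min f g : wlip V := Wlip (wlip_minP f g).
Definition wlip_cst c : wlip V := Wlip (wlip_cstP c).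
Definition wlip_eval x : wlip V := Wlip (wlip_evalP x).

Record closed_sublattice (S : set (wlip V)) : Prop := {
  sublattice_linear : forall (a : R) f g, S f -> S g -> S (a *: f + g) ;
  sublattice_max : forall f g, S f -> S g -> S (wlip_max f g) ;
  sublattice_min : forall f g, S f -> S g -> S (wlip_min f g) ;
  sublattice_closed : closed S }.

(* Membership in the smallest norm-closed linear sublattice of wlip V containing
   the constants and the evaluations at points of V. *)
Definition lip_lattice_functional : {pred wlip V} :=
  fun f => `[< forall S : set (wlip V), closed_sublattice S ->
    range wlip_cst `<=` S -> range wlip_eval `<=` S -> S f >].

Lemma lip_lattice_functional_submod_closed :
  submod_closed lip_lattice_functional.
Proof.
split.
  apply/asboolP => S _ cS _; apply: cS; exists 0 => //.
  exact: val_inj.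
move=> a f g /asboolP Lf /asboolP Lg; apply/asboolP => S SS cS eS.
by apply: (sublattice_linear SS); [exact: Lf|exact: Lg].
Qed.

End lattice_operations.
Arguments lip_lattice_functional {R} V.

Record lip_lattice {R : realType} (V : normedModType R) := LipLattice {
  lip_lattice_val :> wlip V ;
  lip_lattice_valP : lip_lattice_val \in lip_lattice_functional V }.

HB.instance Definition _ {R : realType} (V : normedModType R) :=
  [isSub for @lip_lattice_val R V].
HB.instance Definition _ {R : realType} (V : normedModType R) :=
  [Choice of lip_lattice V by <:].
HB.instance Definition _ {R : realType} (V : normedModType R) :=
  GRing.isSubmodClosed.Build R (wlip V) (lip_lattice_functional V)
    (GRing.submod_closed_semi (lip_lattice_functional_submod_closed V)).
HB.instance Definition _ {R : realType} (V : normedModType R) :=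
  [SubChoice_isSubLmodule of lip_lattice V by <:].

Section lip_lattice_norm.
Context {R : realType} (V : normedModType R).
Implicit Types f g : lip_lattice V.

Definition lip_lattice_norm f : R := `|lip_lattice_val f|.

Lemma lip_lattice_normD f g :
  lip_lattice_norm (f + g) <= lip_lattice_norm f + lip_lattice_norm g.
Proof. exact: ler_normD. Qed.

Lemma lip_lattice_normZ (a : R) f :
  lip_lattice_norm (a *: f) = `|a| * lip_lattice_norm f.
Proof. exact: normrZ. Qed.

Lemma lip_lattice_norm_eq0 f : lip_lattice_norm f = 0 -> f = 0.
Proof. by move=> /normr0_eq0 f0; exact: val_inj. Qed.

HB.instance Definition _ :=
  Lmodule_isNormed.Build R (lip_lattice V)
    lip_lattice_normD lip_lattice_normZ lip_lattice_norm_eq0.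

End lip_lattice_norm.

Lemma lip_lattice_le_norm {R : realType} (V : normedModType R)
  (f : lip_lattice V) (b : dual_ball V) : `|f b| <= `|f|.
Proof. exact: wlip_norm_ub. Qed.

Lemma deltaP {R : realType} (V : normedModType R) (b : dual_ball V) :
  (fun f : lip_lattice V => f b) \in continuous_functional (lip_lattice V).
Proof.
have lin : linear (fun f : lip_lattice V => f b : R^o) by [].
apply/asboolP; split=> //.
pose ev : {linear lip_lattice V -> R^o} := HB.pack
  (fun f : lip_lattice V => f b : R^o) (GRing.isLinear.Build _ _ _ _ _ lin).
apply: (@bounded_linear_continuous _ _ _ ev); apply/linear_boundedP.
near=> r => f /=; rewrite (le_trans (lip_lattice_le_norm f b))//.
by rewrite ler_peMl//; near: r; exact: nbhs_pinfty_ge.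
Unshelve. all: by end_near. Qed.

Definition delta {R : realType} (V : normedModType R) (b : dual_ball V) :
  dual_space (lip_lattice V) := Dual (deltaP b).

(* Since the ball is convex, c exists for all a, b and t. *)
Definition concave_on_ball {R : realType} (V : normedModType R)
    (f : dual_ball V -> R) : Prop :=
  forall (t : R) (a b c : dual_ball V), 0 <= t <= 1 ->
    ball_val c = t *: ball_val a + (1 - t) *: ball_val b ->
    t * f a + (1 - t) * f b <= f c.

Definition separable_set {T : topologicalType} (A : set T) : Prop :=
  exists D : set T, [/\ countable D, D `<=` A & A `<=` closure D].

Lemma adjointP {R : realType} (Y X : normedModType R) (U : {linear Y -> X})
    (cU : continuous U) (f : dual_space X) :
  (fun y => f (U y)) \in continuous_functional Y.
Proof.
apply/asboolP; split; first by move=> a u v; rewrite !linearP.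
move=> y; apply: continuous_comp; first exact: cU.
exact: dual_continuous.
Qed.

Definition adjoint {R : realType} (Y X : normedModType R)
    (U : {linear Y -> X}) (cU : continuous U) (f : dual_space X) : dual_space Y :=
  Dual (adjointP cU f).

Definition weak_star_compact {R : realType} (X : normedModType R)
  (K : set (dual_space X)) : Prop := compact (K : set (weak_star X)).

Definition Radon_Nikodym_set {R : realType} (X : normedModType R)
    (K : set (dual_space X)) : Prop :=
  weak_star_compact K /\
  forall Y : completeNormedModType R, separable_set [set: Y] ->
  forall (U : {linear Y -> X}) (cU : continuous U),
    separable_set (adjoint cU @` K).

(* Main.v *)
From HB Require Import structures.
Require Import Defs.
From mathcomp Require Import all_boot all_order all_algebra.
From mathcomp Require Import all_classical all_reals all_analysis.
From mathcomp Require Import ring lra.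

Set Implicit Arguments.
Unset Strict Implicit.
Unset Printing Implicit Defensive.

Import Order.TTheory GRing.Theory Num.Theory.
Import numFieldNormedType.Exports.

Local Open Scope classical_set_scope.
Local Open Scope ring_scope.

(** The inclusion from right to left holds because the isometric image of a
    weak* compact set under [delta] is norm closed ([delta_image_closed]).

    Conversely, every [x0] in [K] is the exact value of [lambda0] at a suitable
    concave function.  For vectors [v] in the unit ball the function
    [tent x0 v : b |-> - |b v - x0 v|] is concave and vanishes at [x0], so a
    convergent positive combination of tents is maximal on [K] at [x0] and at
    those points of [K] that agree with [x0] on every [v] in use.  Hence
    [lambda0] sends it to some [x1] in [K] that agrees with [x0] on countably
    many vectors.  If these vectors are rich enough to recognise that
    [x1 - x0] is small, then [x1 = x0].

    Richness is arranged while the function is being built.  The partial sums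
    [u 0, u 1, ...] are finite combinations of tents; at stage [m], for every
    [k <= m], a vector is added at which the functional
    [restrict (lambda k (u m)) - x0] of [X^*] attains at least half of its norm
    ([dual_half_norming]), where [restrict] pulls functionals on the lattice
    back to [X].  Let [f] be the limit of [u] ([exists_peak]).  By pointwise
    convergence of [lambda k] to [lambda0] and by continuity of each
    [lambda k], the functional [x1 - x0] is a norm limit of functionals
    [restrict (lambda k (u m)) - x0] with [k <= m].  Each of these is half
    normed by a vector at which [x1 - x0] vanishes, so these functionals tend
    to zero and [x1 - x0 = 0]. *)

(** * Completeness of the lattice *)

Section completeness.
Context {R : realType} (V : normedModType R).

Lemma continuous_uniform_limit (T : topologicalType) (u : nat -> T -> R^o)
    (g : T -> R^o) (e : nat -> R) :
    e n @[n --> \oo] --> 0 -> (forall n x, `|g x - u n x| <= e n) ->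
  (forall n, continuous (u n)) -> continuous g.
Proof.
move=> e0 ge cu x; apply/cvgrPdist_lt => eps eps0.
have eps3 : 0 < eps / 3 by rewrite divr_gt0.
have [n _ en] := (cvgr0Pnorm_lt e).1 e0 _ eps3.
have /cvgrPdist_lt/(_ _ eps3) := cu n x; apply: filterS => y.
have := le_lt_trans (ler_norm _) (en n (leqnn n)).
have := ge n x; have := ge n y.
by rewrite !ler_norml !ltr_norml; lra.
Qed.

(** A rate [e] is carried along because the construction of the peak function
    uses the explicit bound at [n = 0] for its norm. *)
Lemma wlip_complete (u : nat -> wlip V) (e : nat -> R) :
    e n @[n --> \oo] --> 0 ->
    (forall n m, (n <= m)%N -> `|u m - u n| <= e n) ->
  exists f : wlip V, forall n, `|f - u n| <= e n.
Proof.
move=> e0 ue.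
have e_lt (eps : R) : 0 < eps -> exists n, e n < eps.
  move=> eps0; have [N _ eN] := (cvgr0Pnorm_lt e).1 e0 _ eps0.
  by exists N; exact: le_lt_trans (ler_norm _) (eN N (leqnn N)).
have uB n m b : (n <= m)%N -> `|u m b - u n b| <= e n.
  by move=> nm; apply: le_trans (ue _ _ nm); exact: wlip_norm_ub (u m - u n) b.
have uL n m a b : (n <= m)%N ->
    `|(u m a - u n a) - (u m b - u n b)| <= e n * `|ball_val a - ball_val b|.
  move=> nm; apply: le_trans (wlip_norm_lip (u m - u n) a b) _.
  by rewrite ler_wpM2r//; exact: ue.
have ucvg b : cvgn (fun n => u n b : R).
  apply: cauchy_cvg; apply: cauchy_exP => eps /e_lt[n en].
  exists (u n b), n => // m /= nm; rewrite /ball /= distrC.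
  exact: le_lt_trans (uB _ _ _ nm) en.
pose g (b : dual_ball V) : R := limn (fun n => u n b : R).
have gB n b : `|g b - u n b| <= e n.
  have c : `|u m b - u n b| @[m --> \oo] --> `|g b - u n b|.
    by apply: cvg_norm; apply: cvgB; [exact: ucvg|exact: cvg_cst].
  by apply: (cvgr_to_le c); exists n => // m /= nm; exact: uB.
have gL n a b :
    `|(g a - u n a) - (g b - u n b)| <= e n * `|ball_val a - ball_val b|.
  have c : `|(u m a - u n a) - (u m b - u n b)| @[m --> \oo] -->
      `|(g a - u n a) - (g b - u n b)|.
    by apply: cvg_norm; apply: cvgB;
      (apply: cvgB; [exact: ucvg|exact: cvg_cst]).
  by apply: (cvgr_to_le c); exists n => // m /= nm; exact: uL.
have gP : (g : dual_ball V -> R^o) \in wlip_functional V.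
  apply/asboolP; split.
    apply: (@continuous_uniform_limit (weak_star_ball V) u g e e0 gB) => n.
    exact: wlip_continuous.
  exists (e 0%N + wlip_norm (u 0%N)) => a b.
  have := gL 0%N a b; have := wlip_norm_lip (u 0%N) a b.
  by rewrite !ler_norml mulrDl; lra.
exists (Wlip gP) => n; apply: wlip_norm_lub => [b|a b].
  exact: gB.
exact: gL.
Qed.

Lemma lip_lattice_complete (u : nat -> lip_lattice V) (e : nat -> R) :
    e n @[n --> \oo] --> 0 ->
    (forall n m, (n <= m)%N -> `|u m - u n| <= e n) ->
  exists f : lip_lattice V, forall n, `|f - u n| <= e n.
Proof.
move=> e0 ue.
have [f fe] := @wlip_complete (fun n => lip_lattice_val (u n)) e e0 ue.
suff fP : f \in lip_lattice_functional V by exists (LipLattice fP).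
apply/asboolP => S SS cS eS.
apply: (closed_cvg S (sublattice_closed SS) (F := \oo)
  (u_ := fun n => lip_lattice_val (u n))).
  by near=> n; have /asboolP fn := lip_lattice_valP (u n); exact: fn.
apply/cvgrPdist_lt => eps /((cvgr0Pnorm_lt e).1 e0).
apply: filterS => n; apply: le_lt_trans.
by apply: le_trans (fe n) _; exact: ler_norm.
Unshelve. all: by end_near. Qed.

End completeness.

(** * Restricting functionals on the lattice to the underlying space *)

Section restriction.
Context {R : realType} (V : normedModType R).

Lemma lip_evalP (v : V) : wlip_eval v \in lip_lattice_functional V.
Proof. by apply/asboolP => S _ _ eS; apply: eS; exists v. Qed.

Definition lip_eval v : lip_lattice V := LipLattice (lip_evalP v).

Lemma lip_eval_linear : linear lip_eval.
Proof.
move=> a v w; apply/val_inj/val_inj/funext => b.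
exact: (linearP (dual_fun (ball_val b)) a v w).
Qed.

HB.instance Definition _ :=
  GRing.isLinear.Build R V (lip_lattice V) _ lip_eval lip_eval_linear.

Lemma lip_eval_norm v : `|lip_eval v| <= `|v|.
Proof.
apply: wlip_norm_lub => [b|a b].
  apply: le_trans (dual_le_norm b v) _.
  by rewrite ler_piMl// ball_valP.
by rewrite mulrC; exact: (dual_le_norm (ball_val a - ball_val b)).
Qed.

Lemma lip_eval_continuous : continuous lip_eval.
Proof.
apply: bounded_linear_continuous; apply/linear_boundedP.
near=> r => v /=; rewrite (le_trans (lip_eval_norm v))//.
by rewrite ler_peMl//; near: r; exact: nbhs_pinfty_ge.
Unshelve. all: by end_near. Qed.

Definition restrict : dual_space (lip_lattice V) -> dual_space V :=
  adjoint lip_eval_continuous.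

Lemma restrictB phi psi : restrict (phi - psi) = restrict phi - restrict psi.
Proof. exact: val_inj. Qed.

Lemma restrict_norm phi : `|restrict phi| <= `|phi|.
Proof.
apply: dual_norm_lub => v v1; apply: (@dual_norm_ub _ _ phi (lip_eval v)).
exact: le_trans (lip_eval_norm v) v1.
Qed.

(** Together with [restrict_norm] and [delta_dist] this shows that [delta] is an
    isometry with contractive left inverse [restrict]. *)
Lemma restrict_delta b : restrict (delta b) = ball_val b.
Proof. exact: val_inj. Qed.

Lemma delta_dist (a b : dual_ball V) :
  `|delta a - delta b| <= `|ball_val a - ball_val b|.
Proof.
apply: dual_norm_lub => f f1.
apply: (le_trans (@wlip_norm_lip _ _ (lip_lattice_val f) a b)).
by rewrite ler_piMl.
Qed.

(** The supremum that defines the dual norm need not be attained; attaining half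
    of it suffices to detect small norms. *)
Lemma dual_half_norming (phi : dual_space V) :
  exists v, `|v| <= 1 /\ `|phi| <= 2 * `|phi v|.
Proof.
have [->|phi0] := eqVneq phi 0.
  by exists 0; rewrite !normr0 mulr_ge0.
have : `|phi| / 2 < dual_norm phi.
  by rewrite ltr_pdivrMr// -dual_normE ltr_pMr ?normr_gt0// ltr1n.
move=> /(sup_gt (proj1 (dual_norm_has_sup phi)))[_ [v v1 <-]] h.
by exists v; split => //; rewrite mulrC -ler_pdivrMr// ltW.
Qed.

End restriction.

(** * Weak* compact sets are norm closed *)

Section weak_star_closed.
Context {R : realType} (V : normedModType R).

Lemma weak_star_eval_continuous (v : V) :
  continuous (fun f : weak_star V => dual_fun f v : R^o).
Proof.
move=> f; apply: (@continuous_comp (weak_star V) {ptws V -> R^o} R^o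
    (@dual_fun R V) (@^~ v)).
  exact: initial_continuous.
exact: (@proj_continuous V (fun=> R^o) v).
Qed.

(** The trace on [K] of the norm neighbourhoods of a point [p] of the norm
    closure has a weak* cluster point [q] in [K]; evaluation at each vector is
    continuous for both topologies, which forces [p = q]. *)
Lemma weak_star_compact_closed (K : set (dual_space V)) :
  weak_star_compact K -> closed K.
Proof.
move=> Kc p pK.
have FF := @within_nbhs_proper (dual_space V) K p pK.
pose F := within K (@nbhs (dual_space V) (dual_space V) p).
have [q [Kq clq]] := Kc F FF (@withinT (dual_space V) (nbhs p) K _).
suff -> : p = q by [].
apply/val_inj/funext => v; apply/eqP/eqP; apply: contrapT => /eqP pq.
have d0 : 0 < `|p v - q v| / 2 by rewrite divr_gt0// normr_gt0 subr_eq0.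
have nearp : F [set r : dual_space V |
    `|p v - r v| < `|p v - q v| / 2].
  rewrite /F /within /=; near_simpl; apply/nbhs_normP.
  exists (`|p v - q v| / 2 / (`|v| + 1)) => [|r /= + _].
    by rewrite /= divr_gt0// ltr_wpDl.
  rewrite ltr_pdivlMr// => pr; apply: le_lt_trans (dual_le_norm (p - r) v) _.
  by apply: le_lt_trans pr; rewrite ler_wpM2l// lerDl.
have /cvgrPdist_lt/(_ _ d0) nearq := @weak_star_eval_continuous v q.
have [r [/= pr qr]] := clq _ _ nearp nearq.
have := ler_distD (r v) (p v) (q v); rewrite (distrC (r v)).
by have := ltrD pr qr; rewrite -splitr => /lt_le_trans h /h; rewrite ltxx.
Qed.

(** A limit [phi] of points [delta x] is [delta] of its own restriction, since
    [restrict] maps the approximating points back to [K]. *)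
Lemma delta_image_closed (K : set (dual_space V)) : weak_star_compact K ->
  closed [set delta x | x in [set x : dual_ball V | K x]].
Proof.
move=> /weak_star_compact_closed Kc phi phi_cl.
have approx eps : 0 < eps -> exists x : dual_ball V,
    K x /\ `|phi - delta x| < eps.
  move=> eps0; have [|_ [[x Kx <-] ?]] := phi_cl [set psi | `|phi - psi| < eps].
    exact: (cvgr_dist_lt _ _ cvg_id).
  by exists x.
have restrict_near x : `|restrict phi - ball_val x| <= `|phi - delta x|.
  by rewrite -restrict_delta -restrictB restrict_norm.
have Kphi : K (restrict phi).
  apply: Kc => A /nbhs_normP[eps /= eps0 epsA].
  have [x [Kx /(le_lt_trans (restrict_near x)) xeps]] := approx eps eps0.
  by exists x; split => //; exact: epsA.
have phi1 : `|restrict phi| <= 1.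
  apply/ler_addgt0Pr => eps /approx[x [_ xeps]].
  rewrite -(subrK (ball_val x) (restrict phi)) addrC [leRHS]addrC.
  apply: le_trans (ler_normD _ _) _.
  by rewrite addrC lerD ?ball_valP// ltW// (le_lt_trans (restrict_near x)).
have [b bE] : exists b : dual_ball V, ball_val b = restrict phi.
  by exists (DualBall phi1).
exists b; first by rewrite /= bE.
apply/eqP; rewrite eq_sym -subr_eq0 -normr_le0.
apply/ler_addgt0Pr => eps eps0; rewrite add0r.
have [|x [_ xeps]] := approx (eps / 2); first by rewrite divr_gt0.
rewrite -(subrK (delta x) phi) -addrA; apply: le_trans (ler_normD _ _) _.
rewrite [leRHS]splitr lerD// ?ltW//.
apply: le_lt_trans (delta_dist x b) _.
by rewrite bE distrC; exact: le_lt_trans (restrict_near x) xeps.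
Qed.

End weak_star_closed.

(** * Concave functions and tents *)

Section concave_functions.
Context {R : realType} (V : normedModType R).
Implicit Types (f g : lip_lattice V) (b : dual_ball V).

Lemma concave_on_ballD f g :
  concave_on_ball f -> concave_on_ball g -> concave_on_ball (f + g).
Proof.
move=> cf cg t a b c t01 cE; have := cf t a b c t01 cE.
have := cg t a b c t01 cE; rewrite -[(f + g) _]/(f a + g a).
by rewrite -[(f + g) b]/(f b + g b) -[(f + g) c]/(f c + g c); lra.
Qed.

Lemma concave_on_ballZ (r : R) f :
  0 <= r -> concave_on_ball f -> concave_on_ball (r *: f).
Proof.
move=> r0 cf t a b c t01 cE; rewrite -[(r *: f) c]/(r * f c).
rewrite -[(r *: f) a]/(r * f a) -[(r *: f) b]/(r * f b).
by apply: le_trans (ler_wpM2l r0 (cf t a b c t01 cE)); rewrite mulrDr; lra.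
Qed.

Lemma concave_on_ball_sum n (F : 'I_n -> lip_lattice V) :
  (forall i, concave_on_ball (F i)) -> concave_on_ball (\sum_i F i).
Proof.
move=> cF; apply: (big_ind (fun f : lip_lattice V => concave_on_ball f)) => //.
  by move=> t a b c _ _ /=; rewrite !mulr0 addr0.
exact: concave_on_ballD.
Qed.

Lemma cvg_pointwise (u : nat -> lip_lattice V) f b :
  u n @[n --> \oo] --> f -> u n b @[n --> \oo] --> (f b : R^o).
Proof.
move=> uf.
exact: (@cvg_comp _ _ _ u (delta b : lip_lattice V -> R^o) _ _ _ uf
  (@dual_continuous _ _ (delta b) f)).
Qed.

Lemma concave_on_ball_cvg (u : nat -> lip_lattice V) f :
    u n @[n --> \oo] --> f -> (forall n, concave_on_ball (u n)) ->
  concave_on_ball f.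
Proof.
move=> uf cu t a b c t01 cE.
have lhs : t * u n a + (1 - t) * u n b @[n --> \oo] --> t * f a + (1 - t) * f b.
  by apply: cvgD; apply: cvgMr; exact: cvg_pointwise.
apply: (ler_cvg_to lhs (cvg_pointwise (b := c) uf)).
by near=> n; exact: cu cE.
Unshelve. all: by end_near. Qed.

End concave_functions.

Section tent.
Context {R : realType} (V : normedModType R) (x0 : dual_ball V).

Lemma lip_minP (f g : lip_lattice V) :
  wlip_min f g \in lip_lattice_functional V.
Proof.
apply/asboolP => S SS cS eS.
have /asboolP fS := lip_lattice_valP f; have /asboolP gS := lip_lattice_valP g.
by apply: (sublattice_min SS); [exact: fS|exact: gS].
Qed.

Lemma lip_cstP (c : R) : wlip_cst V c \in lip_lattice_functional V.
Proof. by apply/asboolP => S _ cS _; apply: cS; exists c. Qed.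

Definition tent (v : V) : lip_lattice V :=
  let h := lip_eval v - LipLattice (lip_cstP (x0 v)) in
  LipLattice (lip_minP h (- h)).

Lemma tentE v b : tent v b = - `|b v - x0 v|.
Proof.
rewrite -[LHS]/(Num.min (b v - x0 v) (- (b v - x0 v))).
move: (b v - x0 v : R) => d.
by case: (ler0P d); case: (lerP d (- d)); lra.
Qed.

Lemma tent_le0 v b : tent v b <= 0.
Proof. by rewrite tentE oppr_le0. Qed.

Lemma tent_center v : tent v x0 = 0.
Proof. by rewrite tentE subrr normr0 oppr0. Qed.

Lemma tent_norm v : `|v| <= 1 -> `|tent v| <= 2.
Proof.
move=> v1.
have le1 (b : dual_ball V) : `|b v| <= 1.
  apply: le_trans (dual_le_norm b v) _.
  by rewrite mulr_ile1// ball_valP.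
apply: wlip_norm_lub => [b|a b].
  rewrite tentE normrN normr_id (le_trans (ler_normB _ _))//.
  by have := le1 b; have := le1 x0; lra.
rewrite !tentE -opprD normrN; apply: (le_trans (ler_dist_dist _ _)).
rewrite [X in `|X|](_ : _ = a v - b v); last by lra.
apply: le_trans (dual_le_norm (ball_val a - ball_val b) v) _.
by rewrite mulrC ler_wpM2r// (le_trans v1)// ler1n.
Qed.

Lemma tent_concave v : concave_on_ball (tent v).
Proof.
move=> t a b c /andP[t0 t1] cE; rewrite !tentE.
have -> : c v = t * a v + (1 - t) * b v.
  by rewrite /= cE.
have t1' : 0 <= 1 - t by rewrite subr_ge0.
rewrite !mulrN -opprD lerN2.
have -> : t * a v + (1 - t) * b v - x0 v =
  t * (a v - x0 v) + (1 - t) * (b v - x0 v) by lra.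
apply: le_trans (ler_normD _ _) _.
by rewrite !normrM (ger0_norm t0) (ger0_norm t1').
Qed.

End tent.

(** * Peak functions adapted to a choice of vectors *)

Section peak.
Context {R : realType} (V : normedModType R) (x0 : dual_ball V)
  (probe : nat -> lip_lattice V -> V) (probe_le1 : forall k f, `|probe k f| <= 1).

(** The vectors used at a stage depend on the function built so far; [probe k f]
    is to half norm [restrict (lambda k f) - x0].  The [m.+1] tents of a stage
    are averaged, and a tent has norm at most 2, so that the weights make the
    total norm at most [1/2 + 1/4 + ... = 1]. *)
Definition peak_step (m : nat) (f : lip_lattice V) : lip_lattice V :=
  (2^-1 ^+ m.+2 / m.+1%:R) *: \sum_(k < m.+1) tent x0 (probe k f).

Fixpoint peak_approx (m : nat) : lip_lattice V :=
  if m is m'.+1 then peak_approx m' + peak_step m' (peak_approx m') else 0.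

Lemma peak_step_coef_gt0 m : 0 < 2^-1 ^+ m.+2 / m.+1%:R :> R.
Proof. by rewrite divr_gt0// exprn_gt0. Qed.

Lemma peak_stepE m f b : peak_step m f b =
  2^-1 ^+ m.+2 / m.+1%:R * \sum_(k < m.+1) tent x0 (probe k f) b.
Proof.
rewrite -[LHS]/(2^-1 ^+ m.+2 / m.+1%:R *
  delta b (\sum_(k < m.+1) tent x0 (probe k f))).
by rewrite linear_sum.
Qed.

Lemma peak_step_le0 m f b : peak_step m f b <= 0.
Proof.
rewrite peak_stepE pmulr_rle0 ?peak_step_coef_gt0//.
by apply: sumr_le0 => k _; exact: tent_le0.
Qed.

Lemma peak_step_norm m f : `|peak_step m f| <= 2^-1 ^+ m.+1.
Proof.
rewrite normrZ gtr0_norm ?peak_step_coef_gt0//.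
have : `|\sum_(k < m.+1) tent x0 (probe k f)| <= 2 * m.+1%:R.
  apply: le_trans (ler_norm_sum _ _ _) _.
  rewrite mulr_natr -[X in _ *+ X]card_ord -sumr_const.
  by apply: ler_sum => k _; exact: tent_norm.
move=> /(ler_wpM2l (ltW (peak_step_coef_gt0 m)))/le_trans; apply.
by rewrite exprS le_eqVlt; apply/orP; left; apply/eqP; field.
Qed.

Lemma peak_step_concave m f : concave_on_ball (peak_step m f).
Proof.
apply: concave_on_ballZ; first exact/ltW/peak_step_coef_gt0.
by apply: concave_on_ball_sum => k; exact: tent_concave.
Qed.

Lemma peak_approx_concave m : concave_on_ball (peak_approx m).
Proof.
elim: m => [|m IH]; first by move=> t a b c _ _ /=; rewrite !mulr0 addr0.
exact: (concave_on_ballD IH (peak_step_concave m (peak_approx m))).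
Qed.

Lemma peak_approx_dist n m : (n <= m)%N ->
  `|peak_approx m - peak_approx n| <= 2^-1 ^+ n.
Proof.
move=> nm; suff : `|peak_approx m - peak_approx n| <= 2^-1 ^+ n - 2^-1 ^+ m.
  by move=> /le_trans; apply; rewrite gerBl exprn_ge0.
elim: m nm => [|m IH]; first by rewrite leqn0 => /eqP->; rewrite !subrr normr0.
rewrite leq_eqVlt => /predU1P[->|nm]; first by rewrite !subrr normr0.
rewrite /= addrAC; apply: le_trans (ler_normD _ _) _.
have := IH nm; have := peak_step_norm m (peak_approx m).
by rewrite exprSr; lra.
Qed.

Lemma peak_approx_nonincreasing b n m : (n <= m)%N ->
  peak_approx m b <= peak_approx n b.
Proof.
elim: m => [|m IH]; first by rewrite leqn0 => /eqP->.
rewrite leq_eqVlt => /predU1P[->//|nm].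
apply: le_trans (IH nm); rewrite /= -[leLHS]/(peak_approx m b + peak_step m _ b).
by rewrite gerDl peak_step_le0.
Qed.

Lemma peak_approx_center m : peak_approx m x0 = 0.
Proof.
elim: m => [//|m IH] /=; rewrite -[LHS]/(peak_approx m x0 + peak_step m _ x0).
by rewrite IH add0r peak_stepE big1 ?mulr0// => k _; exact: tent_center.
Qed.

(** Since all increments are nonpositive, a zero of the limit [f] is a zero of
    every tent that was added: at such a point all the probed vectors take the
    same value as at [x0]. *)
Lemma exists_peak : exists f : lip_lattice V,
  [/\ concave_on_ball f /\ `|f| <= 1, peak_approx n @[n --> \oo] --> f,
      f x0 = 0, forall b, f b <= 0 &
      forall b, f b = 0 -> forall k m, (k <= m)%N ->
        b (probe k (peak_approx m)) = x0 (probe k (peak_approx m))].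
Proof.
have half : (2^-1 : R) ^+ n @[n --> \oo] --> (0 : R).
  by apply: cvg_expr; rewrite gtr0_norm// invf_lt1// ltr1n.
have [f fu] := lip_lattice_complete half peak_approx_dist.
have uf : peak_approx n @[n --> \oo] --> f.
  apply/cvgrPdist_lt => eps /((cvgr0Pnorm_lt _).1 half).
  apply: filterS => n; apply: le_lt_trans.
  by apply: le_trans (fu n) _; exact: ler_norm.
have f_le n b : f b <= peak_approx n b.
  apply: (cvgr_to_le (cvg_pointwise (b := b) uf)).
  by exists n => // m /= nm; exact: peak_approx_nonincreasing.
exists f; split=> //.
- split; first exact: concave_on_ball_cvg uf peak_approx_concave.
  by have := fu 0%N; rewrite subr0 expr0.
- apply/eqP; rewrite eq_le (f_le 0%N x0) /=.
  apply: (cvgr_to_ge (cvg_pointwise (b := x0) uf)).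
  by exists 0%N => // n _; rewrite /= peak_approx_center.
- by move=> b; exact: (f_le 0%N).
- move=> b fb0 k m km.
  have step0 : 0 <= peak_step m (peak_approx m) b.
    rewrite -fb0; apply: le_trans (f_le m.+1 b) _.
    rewrite -[leLHS]/(peak_approx m b + peak_step m (peak_approx m) b).
    by rewrite gerDr; exact: (peak_approx_nonincreasing b (leq0n m)).
  move: step0; rewrite peak_stepE pmulr_rge0 ?peak_step_coef_gt0//.
  rewrite (bigD1 (Ordinal (km : (k < m.+1)%N)))//= => sum0.
  have : 0 <= tent x0 (probe k (peak_approx m)) b.
    apply: le_trans sum0 _; rewrite gerDl.
    by apply: sumr_le0 => i _; exact: tent_le0.
  by rewrite tentE oppr_ge0 normr_le0 subr_eq0 => /eqP.
Qed.

End peak.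

(** * Every point of K is a value at a concave function *)

Theorem mainTheorem2 (R : realType) (X : completeNormedModType R)
    (K : set (dual_space X))
    (K_neq0 : K !=set0)
    (K_ball : K `<=` [set x | `|x| <= 1])
    (K_RN : Radon_Nikodym_set K)
    (lambda : nat -> lip_lattice X -> dual_space (lip_lattice X))
    (lambda_continuous : forall n, continuous (lambda n))
    (lambda_le1 : forall n f, `|lambda n f| <= 1)
    (lambda0 : lip_lattice X -> dual_space (lip_lattice X))
    (lambda_cvg : forall f, lambda n f @[n --> \oo] --> lambda0 f)
    (lambda0_max : forall f, exists x : dual_ball X,
      [/\ K x, lambda0 f = delta x &
        f x = sup [set f y | y in [set y : dual_ball X | K y]]]) :
  [set delta x | x in [set x : dual_ball X | K x]] =
  closure (lambda0 @` [set f : lip_lattice X |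
    concave_on_ball f /\ `|f| <= 1]).
Proof.
apply/seteqP; split; last first.
  have -> : [set delta x | x in [set x : dual_ball X | K x]] =
      closure [set delta x | x in [set x : dual_ball X | K x]].
    exact/closure_id/delta_image_closed/K_RN.1.
  apply: closure_subset => _ [f _ <-].
  by have [x [Kx -> _]] := lambda0_max f; exists x.
move=> _ [x0 Kx0 <-]; apply: subset_closure.
pose gap k f := restrict (lambda k f) - ball_val x0.
(* The dependence of the vector on both [k] and the function is what lets the
   recursion of [peak_approx] react to the values of all the [lambda k]. *)
have /choice[v v_norming] (p : nat * lip_lattice X) :=
  dual_half_norming (gap p.1 p.2).
pose probe k f := v (k, f).
have probe_le1 k f : `|probe k f| <= 1 by have [] := v_norming (k, f).
have [f [fC uf f0 f_le0 f_eq0]] := exists_peak x0 probe_le1.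
set u := peak_approx x0 probe in uf f_eq0.
exists f => //.
have [x1 [Kx1 lx1 f_max]] := lambda0_max f.
have fx1 : f x1 = 0.
  apply/eqP; rewrite eq_le f_le0 f_max -f0 /=; apply: ub_le_sup.
    by exists 0 => _ [y _ <-]; exact: f_le0.
  by exists x0.
rewrite lx1; congr delta; apply/val_inj/eqP.
rewrite -subr_eq0 -normr_le0; apply/ler_addgt0Pr => eps eps0; rewrite add0r.
have eps6 : 0 < eps / 6 by rewrite divr_gt0.
have /cvgrPdist_lt/(_ _ eps6)[k _ /(_ k (leqnn k)) lk] := lambda_cvg f.
have /cvgrPdist_lt/(_ _ eps6)[j _ lj] :
    lambda k (u n) @[n --> \oo] --> lambda k f.
  by apply: continuous_cvg uf; exact: lambda_continuous.
(* The stage must be late for the approximation and at least [k], so that the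
   vector probing [lambda k (u m)] has been added to [f]. *)
pose m := maxn j k.
have {}lj : `|lambda k f - lambda k (u m)| < eps / 6 by apply: lj; exact: leq_maxl.
have near_gap : `|(ball_val x1 - ball_val x0) - gap k (u m)| <= eps / 3.
  have -> : (ball_val x1 - ball_val x0) - gap k (u m) =
      restrict (lambda0 f - lambda k (u m)).
    by rewrite /gap restrictB lx1 restrict_delta opprB addrA subrK.
  apply: le_trans (restrict_norm _) _.
  rewrite -(subrK (lambda k f) (lambda0 f)) -addrA.
  by apply: le_trans (ler_normD _ _) _; lra.
have gap_small : `|gap k (u m)| <= 2 * (eps / 3).
  have [w1 /le_trans] := v_norming (k, u m); apply; rewrite ler_wpM2l//.
  have agree : (ball_val x1 - ball_val x0) (probe k (u m)) = 0.
    apply/eqP; rewrite -[eqbLHS]/(x1 _ - x0 _) subr_eq0; apply/eqP.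
    by apply: f_eq0 => //; exact: leq_maxr.
  apply: le_trans near_gap; rewrite -normrN -(add0r (- _)) -agree.
  exact: (@dual_norm_ub _ _ (ball_val x1 - ball_val x0 - gap k (u m)) _ w1).
rewrite -(subrK (gap k (u m)) (ball_val x1 - ball_val x0)).
by apply: le_trans (ler_normD _ _) _; lra.
Qed.
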